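(* Let $\mathcal C$ be a strong balanced factorization category satisfying the Nullstellensatz hypothesis. Let $P$ be an atom in $\mathcal C$ and let $x:P\to X$ be any map in $\mathcal C$. Then the reflection $\downarrow_X x$ of $x$ in $\mathcal M/X$ is in the fixed category of conjugate objects in $\mathcal M/X$, and the reflection $\uparrow_X x$ of $x$ in $\mathcal M'/X$ is in the fixed category of conjugate objects in $\mathcal M'/X$ (for the bimodule $\mathrm{ten}_X$).
   Context: A balanced factorization category (bfc) is a finitely complete category $\mathcal C$ with two (orthogonal) factorization systems $(\mathcal E,\mathcal M)$ and $(\mathcal E',\mathcal M')$ satisfying the reciprocal stability law: the pullback of a map in $\mathcal E$ along a map in $\mathcal M'$ is in $\mathcal E$, and the pullback of a map in $\mathcal E'$ along a map in $\mathcal M$ is in $\mathcal E'$. $\mathcal M/X$ (resp. $\mathcal M'/X$) is the full subcategory of $\mathcal C/X$ on the objects lying in $\mathcal M$ (resp. $\mathcal M'$). The bfc is strong if $\mathcal M/1=\mathcal M'/1$; this category is denoted $\mathcal S$, and $\pi_0:\mathcal C\to\mathcal S$ is the left adjoint of the inclusion $\mathcal S\hookrightarrow\mathcal C$. Nullstellensatz hypothesis: for every object $X$ of $\mathcal C$, the map $\mathcal C(1,X)\to\mathcal C(1,\pi_0X)$ given by composition with the unit $X\to\pi_0X$ is surjective. For $x:P\to X$, $\downarrow_X x\in\mathcal M/X$ (resp. $\uparrow_X x\in\mathcal M'/X$) is the second factor of an $(\mathcal E,\mathcal M)$- (resp. $(\mathcal E',\mathcal M')$-) factorization of $x$. For $n:D\to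 X$ in $\mathcal M'/X$ and $m:A\to X$ in $\mathcal M/X$, put $\mathrm{ten}_X(n,m):=\mathcal C(1,\pi_0(D\times_X A))$, a functor $\mathcal M'/X\times\mathcal M/X\to\mathbf{Set}$ (a bimodule $(\mathcal M'/X)^{op}\to\mathcal M/X$). An element $s\in\mathrm{ten}_X(n,m)$ is bicartesian if for all $m'\in\mathcal M/X$ the map $\mathcal M/X(m,m')\to\mathrm{ten}_X(n,m')$, $g\mapsto\mathrm{ten}_X(n,g)(s)$, is a bijection and for all $n'\in\mathcal M'/X$ the map $\mathcal M'/X(n,n')\to\mathrm{ten}_X(n',m)$, $h\mapsto\mathrm{ten}_X(h,m)(s)$, is a bijection. An object $m\in\mathcal M/X$ (resp. $n\in\mathcal M'/X$) is conjugate if there is a bicartesian element of $\mathrm{ten}_X(n,m)$ for some $n$ (resp. for some $m$); the fixed categories are the full subcategories of conjugate objects. An object $P$ of $\mathcal C$ is an atom if there is a bicartesian element of $\mathrm{ten}_P(1_P,1_P)$, where $1_P$ is the identity of $P$, viewed as the terminal object both of $\mathcal M'/P$ and of $\mathcal M/P$. *)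

(* Defs.v *)
From Corelib Require Import ssreflect ssrfun.
From Stdlib Require Import FunctionalExtensionality ProofIrrelevance.

Set Implicit Arguments.
Unset Strict Implicit.
Unset Printing Implicit Defensive.

Declare Scope cat_scope.
Delimit Scope cat_scope with cat.
Local Open Scope cat_scope.

Record category := Category {
  ob :> Type;
  hom : ob -> ob -> Type;
  idm : forall x, hom x x;
  compose : forall x y z, hom y z -> hom x y -> hom x z;
  compose1m : forall x y (f : hom x y), compose (idm y) f = f;
  composem1 : forall x y (f : hom x y), compose f (idm x) = f;
  composeA : forall x y z w (h : hom z w) (g : hom y z) (f : hom x y),
    compose h (compose g f) = compose (compose h g) f
}.
Arguments hom {c} _ _.
Arguments idm {c} x.
Arguments compose {c x y z} _ _.
Notation "g ∘ f" := (compose g f) (at level 40, left associativity) : cat_scope.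

Record functor (C D : category) := Functor {
  fob :> C -> D;
  fmap : forall x y : C, hom x y -> hom (fob x) (fob y);
  fmap1 : forall x : C, fmap (idm x) = idm (fob x);
  fmapM : forall (x y z : C) (g : hom y z) (f : hom x y),
    fmap (g ∘ f) = fmap g ∘ fmap f
}.
Arguments fmap {C D} _ {x y} _.

Lemma functor_comp_1 (B C D : category) (G : functor C D) (F : functor B C) (x : B) :
  fmap G (fmap F (idm x)) = idm (G (F x)).
Proof. by rewrite !fmap1. Qed.

Lemma functor_comp_M (B C D : category) (G : functor C D) (F : functor B C)
    (x y z : B) (g : hom y z) (f : hom x y) :
  fmap G (fmap F (g ∘ f)) = fmap G (fmap F g) ∘ fmap G (fmap F f).
Proof. by rewrite !fmapM. Qed.

Definition functor_comp (B C D : category) (G : functor C D) (F : functor B C) :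
    functor B D :=
  @Functor B D (fun x => G (F x)) (fun x y f => fmap G (fmap F f))
    (functor_comp_1 G F) (functor_comp_M G F).

Definition type_cat : category :=
  @Category Type (fun A B => A -> B) (fun A a => a) (fun A B C g f a => g (f a))
    (fun _ _ _ => erefl) (fun _ _ _ => erefl) (fun _ _ _ _ _ _ _ => erefl).

Section Product.
Variables C D : category.
Let phom (x y : C * D) : Type := (hom x.1 y.1 * hom x.2 y.2)%type.

Lemma prod_cat_1m (x y : C * D) (f : phom x y) : (idm y.1 ∘ f.1, idm y.2 ∘ f.2) = f.
Proof. by rewrite !compose1m; case: f. Qed.

Lemma prod_cat_m1 (x y : C * D) (f : phom x y) : (f.1 ∘ idm x.1, f.2 ∘ idm x.2) = f.
Proof. by rewrite !composem1; case: f. Qed.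

Lemma prod_cat_A (x y z w : C * D) (h : phom z w) (g : phom y z) (f : phom x y) :
  (h.1 ∘ (g.1 ∘ f.1), h.2 ∘ (g.2 ∘ f.2)) = ((h.1 ∘ g.1) ∘ f.1, (h.2 ∘ g.2) ∘ f.2).
Proof. by rewrite !composeA. Qed.

Definition prod_cat : category :=
  @Category (C * D)%type phom (fun x => (idm x.1, idm x.2))
    (fun x y z g f => (g.1 ∘ f.1, g.2 ∘ f.2)) prod_cat_1m prod_cat_m1 prod_cat_A.
End Product.

Definition full_subcat (C : category) (P : C -> Prop) : category :=
  @Category {x : C | P x} (fun a b => hom (proj1_sig a) (proj1_sig b))
    (fun a => idm (proj1_sig a)) (fun a b c g f => g ∘ f)
    (fun a b f => compose1m f) (fun a b f => composem1 f)
    (fun a b c d h g f => composeA h g f).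

Definition full_incl (C : category) (P : C -> Prop) : functor (full_subcat P) C :=
  @Functor (full_subcat P) C (fun a => proj1_sig a) (fun a b f => f)
    (fun a => erefl) (fun a b c g f => erefl).

Section Slice.
Variables (C : category) (X : C).

Record over := Over { dom : C; str : hom dom X }.

Definition over_hom (a b : over) : Type := {g : hom (dom a) (dom b) | str b ∘ g = str a}.

Lemma over_hom_eq (a b : over) (f g : over_hom a b) : proj1_sig f = proj1_sig g -> f = g.
Proof.
case: f g => [f Hf] [g Hg] /= E; subst g.
by rewrite (proof_irrelevance _ Hf Hg).
Qed.

Definition over_id (a : over) : over_hom a a := exist _ (idm (dom a)) (composem1 (str a)).

Lemma over_comp_proof (a b c : over) (g : over_hom b c) (f : over_hom a b) :
  str c ∘ (proj1_sig g ∘ proj1_sig f) = str a.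
Proof. by rewrite composeA (proj2_sig g) (proj2_sig f). Qed.

Definition over_comp (a b c : over) (g : over_hom b c) (f : over_hom a b) : over_hom a c :=
  exist _ (proj1_sig g ∘ proj1_sig f) (over_comp_proof g f).

Lemma over_1m (a b : over) (f : over_hom a b) : over_comp (over_id b) f = f.
Proof. by apply: over_hom_eq; apply: compose1m. Qed.

Lemma over_m1 (a b : over) (f : over_hom a b) : over_comp f (over_id a) = f.
Proof. by apply: over_hom_eq; apply: composem1. Qed.

Lemma over_A (a b c d : over) (h : over_hom c d) (g : over_hom b c) (f : over_hom a b) :
  over_comp h (over_comp g f) = over_comp (over_comp h g) f.
Proof. by apply: over_hom_eq; apply: composeA. Qed.

Definition slice : category := Category over_1m over_m1 over_A.

Definition slice_dom : functor slice C :=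
  @Functor slice C dom (fun a b f => proj1_sig f) (fun a => erefl)
    (fun a b c g f => erefl).
End Slice.

Record left_adjoint (C D : category) (G : functor D C) := LeftAdjoint {
  la_functor :> functor C D;
  la_unit : forall x : C, hom x (G (la_functor x));
  la_natural : forall (x y : C) (f : hom x y),
    fmap G (fmap la_functor f) ∘ la_unit x = la_unit y ∘ f;
  la_universal : forall (x : C) (d : D) (f : hom x (G d)),
    exists! g : hom (la_functor x) d, fmap G g ∘ la_unit x = f
}.

Record pullback (C : category) (A B X : C) (f : hom A X) (g : hom B X) := Pullback {
  apex :> C;
  pr1 : hom apex A;
  pr2 : hom apex B;
  pb_comm : f ∘ pr1 = g ∘ pr2;
  pb_pair : forall (Z : C) (u : hom Z A) (v : hom Z B), f ∘ u = g ∘ v -> hom Z apex;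
  pb_pair1 : forall (Z : C) (u : hom Z A) (v : hom Z B) (e : f ∘ u = g ∘ v),
    pr1 ∘ pb_pair e = u;
  pb_pair2 : forall (Z : C) (u : hom Z A) (v : hom Z B) (e : f ∘ u = g ∘ v),
    pr2 ∘ pb_pair e = v;
  pb_joint_mono : forall (Z : C) (w w' : hom Z apex),
    pr1 ∘ w = pr1 ∘ w' -> pr2 ∘ w = pr2 ∘ w' -> w = w'
}.
Arguments pr1 {C A B X f g} p.
Arguments pr2 {C A B X f g} p.
Arguments pb_pair {C A B X f g} p {Z u v} e.

Record terminal (C : category) := Terminal {
  tobj :> C;
  bang : forall X : C, hom X tobj;
  bang_unique : forall (X : C) (f : hom X tobj), f = bang X
}.

(* A choice of terminal object and pullbacks; these yield all finite limits. *)
Record finite_limits (C : category) := FiniteLimits {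
  one : terminal C;
  pb : forall (A B X : C) (f : hom A X) (g : hom B X), pullback f g
}.

Definition is_iso (C : category) (X Y : C) (f : hom X Y) : Prop :=
  exists g : hom Y X, g ∘ f = idm X /\ f ∘ g = idm Y.

Definition mor_class (C : category) := forall X Y : C, hom X Y -> Prop.

Record factorization_system (C : category) (E M : mor_class C) : Prop := {
  fs_isoE : forall (X Y : C) (f : hom X Y), is_iso f -> E X Y f;
  fs_isoM : forall (X Y : C) (f : hom X Y), is_iso f -> M X Y f;
  fs_compE : forall (X Y Z : C) (g : hom Y Z) (f : hom X Y),
    E _ _ g -> E _ _ f -> E _ _ (g ∘ f);
  fs_compM : forall (X Y Z : C) (g : hom Y Z) (f : hom X Y),
    M _ _ g -> M _ _ f -> M _ _ (g ∘ f);
  fs_factor : forall (X Y : C) (f : hom X Y),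
    exists (Z : C) (e : hom X Z) (m : hom Z Y), E _ _ e /\ M _ _ m /\ m ∘ e = f;
  fs_orthogonal : forall (A B X Y : C) (e : hom A B) (m : hom X Y)
      (u : hom A X) (v : hom B Y),
    E _ _ e -> M _ _ m -> m ∘ u = v ∘ e ->
    exists! d : hom B X, d ∘ e = u /\ m ∘ d = v
}.

Record bfc := Bfc {
  bfc_cat :> category;
  bfc_lim : finite_limits bfc_cat;
  clE : mor_class bfc_cat;
  clM : mor_class bfc_cat;
  clE' : mor_class bfc_cat;
  clM' : mor_class bfc_cat;
  bfc_fs : factorization_system clE clM;
  bfc_fs' : factorization_system clE' clM';
  bfc_stable : forall (A B X : bfc_cat) (e : hom A X) (n : hom B X) (p : pullback e n),
    clE e -> clM' n -> clE (pr2 p);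
  bfc_stable' : forall (A B X : bfc_cat) (e : hom A X) (m : hom B X) (p : pullback e m),
    clE' e -> clM m -> clE' (pr2 p)
}.
Arguments clE {b X Y} _.
Arguments clM {b X Y} _.
Arguments clE' {b X Y} _.
Arguments clM' {b X Y} _.

(* Elements of a bimodule [N^op -> M], given as a functor [N * M -> Type]. *)
Section Bimodule.
Variables (N M : category) (T : functor (prod_cat N M) type_cat).

Definition bim (n : N) (m : M) : Type := fob T (n, m).

Definition actr (n : N) (m m' : M) (g : hom m m') : bim n m -> bim n m' :=
  @fmap _ _ T (n, m) (n, m') (idm n, g).

Definition actl (n n' : N) (m : M) (h : hom n n') : bim n m -> bim n' m :=
  @fmap _ _ T (n, m) (n', m) (h, idm m).

Definition bicartesian (n : N) (m : M) (s : bim n m) : Prop :=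
  (forall m' : M, bijective (fun g : hom m m' => actr g s)) /\
  (forall n' : N, bijective (fun h : hom n n' => actl h s)).

Definition conjugate_r (m : M) : Prop := exists (n : N) (s : bim n m), bicartesian s.
Definition conjugate_l (n : N) : Prop := exists (m : M) (s : bim n m), bicartesian s.

(* An object lies in a fixed category exactly when it is conjugate. *)
Definition fixed_r : category := full_subcat conjugate_r.
Definition fixed_l : category := full_subcat conjugate_l.
End Bimodule.

Section Balanced.
Variable C : bfc.

Definition inM (X : C) (a : slice X) : Prop := clM (str a).
Definition inM' (X : C) (a : slice X) : Prop := clM' (str a).
Definition sliceM (X : C) : category := full_subcat (@inM X).
Definition sliceM' (X : C) : category := full_subcat (@inM' X).

Definition pt : C := one (bfc_lim C).

(* [M/1] and [M'/1] are equal as full subcategories of [C/1]. *)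
Definition strong : Prop := forall a : slice pt, inM a <-> inM' a.

Definition catS : category := sliceM pt.
Definition inclS : functor catS C := functor_comp (slice_dom pt) (full_incl (@inM pt)).

Section Pi0.
Variable pi0 : left_adjoint inclS.

Definition Pi0 : functor C C := functor_comp inclS pi0.

Definition nullstellensatz : Prop :=
  forall (X : C) (c : hom pt (Pi0 X)), exists p : hom pt X, la_unit pi0 X ∘ p = c.

Section Ten.
Variable X : C.

Definition fiber_prod (a b : slice X) : pullback (str a) (str b) :=
  pb (bfc_lim C) (str a) (str b).

Lemma fiber_map_proof (a a' b b' : slice X) (h : hom a a') (g : hom b b') :
  str a' ∘ (proj1_sig h ∘ pr1 (fiber_prod a b)) =
  str b' ∘ (proj1_sig g ∘ pr2 (fiber_prod a b)).
Proof. by rewrite !composeA (proj2_sig h) (proj2_sig g) pb_comm. Qed.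

Definition fiber_map (a a' b b' : slice X) (h : hom a a') (g : hom b b') :
    hom (apex (fiber_prod a b)) (apex (fiber_prod a' b')) :=
  pb_pair (fiber_prod a' b') (fiber_map_proof h g).

Lemma fiber_map1 (a b : slice X) : fiber_map (idm a) (idm b) = idm _.
Proof.
by apply: pb_joint_mono; rewrite ?pb_pair1 ?pb_pair2 composem1 compose1m.
Qed.

Lemma fiber_mapM (a a' a'' b b' b'' : slice X) (h' : hom a' a'') (h : hom a a')
    (g' : hom b' b'') (g : hom b b') :
  fiber_map (h' ∘ h) (g' ∘ g) = fiber_map h' g' ∘ fiber_map h g.
Proof.
apply: pb_joint_mono.
  by rewrite composeA !pb_pair1 -composeA pb_pair1 composeA.
by rewrite composeA !pb_pair2 -composeA pb_pair2 composeA.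
Qed.

Definition ten_ob (nm : prod_cat (sliceM' X) (sliceM X)) : type_cat :=
  hom pt (Pi0 (fiber_prod (proj1_sig nm.1) (proj1_sig nm.2))).

Definition ten_map (nm nm' : prod_cat (sliceM' X) (sliceM X)) (hg : hom nm nm') :
    hom (ten_ob nm) (ten_ob nm') :=
  fun s => fmap Pi0 (@fiber_map (proj1_sig nm.1) (proj1_sig nm'.1)
                       (proj1_sig nm.2) (proj1_sig nm'.2) hg.1 hg.2) ∘ s.

Lemma ten_map1 (nm : prod_cat (sliceM' X) (sliceM X)) :
  ten_map (idm nm) = idm (ten_ob nm).
Proof.
apply: functional_extensionality => s.
rewrite /ten_map fiber_map1 fmap1; exact: compose1m.
Qed.

Lemma ten_mapM (x y z : prod_cat (sliceM' X) (sliceM X)) (g : hom y z) (f : hom x y) :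
  ten_map (g ∘ f) = ten_map g ∘ ten_map f.
Proof.
apply: functional_extensionality => s.
rewrite /ten_map fiber_mapM fmapM; exact: esym (composeA _ _ _).
Qed.

Definition ten : functor (prod_cat (sliceM' X) (sliceM X)) type_cat :=
  Functor ten_map1 ten_mapM.
End Ten.

Lemma is_iso_id (X : C) : is_iso (idm X).
Proof. by exists (idm X); rewrite compose1m. Qed.

Definition idM (P : C) : sliceM P :=
  exist (@inM P) (Over (idm P)) (fs_isoM (bfc_fs C) (is_iso_id P)).
Definition idM' (P : C) : sliceM' P :=
  exist (@inM' P) (Over (idm P)) (fs_isoM (bfc_fs' C) (is_iso_id P)).

Definition atom (P : C) : Prop :=
  exists s : bim (ten P) (idM' P) (idM P), bicartesian s.
End Pi0.

(* Factorizations are only unique up to isomorphism, so the reflections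
   are given as relations: [m] is some second factor of [x]. *)
Definition is_down (P X : C) (x : hom P X) (m : sliceM X) : Prop :=
  exists e : hom P (dom (proj1_sig m)), clE e /\ str (proj1_sig m) ∘ e = x.

Definition is_up (P X : C) (x : hom P X) (n : sliceM' X) : Prop :=
  exists e : hom P (dom (proj1_sig n)), clE' e /\ str (proj1_sig n) ∘ e = x.
End Balanced.

(* Main.v *)
(** If [x = m ∘ e = n ∘ e'] are the two factorizations of [x], then for every
    [m'] in [M/X]

      [M/X(m, m') ≅ C/X(x, m') ≅ M/P(1_P, x^* m')
         ≅ ten_P(1_P, x^* m') ≅ ten_X(x, m') ≅ ten_X(n, m')].

    The first bijection is orthogonality of [e] and [m'], the second is
    pulling back along [x], the third holds because [P] is an atom.  For the
    last one, [P ×_X A' -> D ×_X A'] is a pullback of [e'] along a map in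
    [M], hence in [E'] by reciprocal stability, and [π0] inverts [E'] because
    [M/1 = M'/1].  The composite is the action on the image of the bicartesian
    element of [P] under [(e', e) : P -> D ×_X A], whose construction is
    symmetric in the two factorization systems. *)

From Corelib Require Import ssreflect ssrfun.
From Stdlib Require Import IndefiniteDescription.
Require Import Defs.

Set Implicit Arguments.
Unset Strict Implicit.
Unset Printing Implicit Defensive.

Local Open Scope cat_scope.

(** * Bijections and pullbacks *)

Lemma inj_surj_bijective (A B : Type) (f : A -> B) :
  injective f -> (forall b, exists a, f a = b) -> bijective f.
Proof.
move=> f_inj f_surj.
(* [bijective] asks for an inverse function, so preimages are chosen. *)
pose g b := proj1_sig (constructive_indefinite_description _ (f_surj b)).
have gK : cancel g f.
  by move=> b; exact: proj2_sig (constructive_indefinite_description _ (f_surj b)).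
by exists g => // a; apply: f_inj; rewrite gK.
Qed.

Lemma iso_compose_bijective (C : category) (W Y Z : C) (f : hom Y Z) :
  is_iso f -> bijective (fun s : hom W Y => f ∘ s).
Proof.
case=> g [gf fg]; exists (fun t => g ∘ t) => s /=.
  by rewrite composeA gf compose1m.
by rewrite composeA fg compose1m.
Qed.

Definition pullback_swap (C : category) (A B X : C) (f : hom A X) (g : hom B X)
    (p : pullback f g) : pullback g f :=
  @Pullback C B A X g f p (pr2 p) (pr1 p) (esym (pb_comm p))
    (fun Z u v e => pb_pair p (esym e))
    (fun Z u v e => pb_pair2 p (esym e)) (fun Z u v e => pb_pair1 p (esym e))
    (fun Z w w' e e' => pb_joint_mono e' e).

Section Paste.
Variables (C : category) (P D B X : C) (f : hom D X) (g : hom B X).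
Variables (x : hom P X) (e : hom P D) (fe : f ∘ e = x).
Variables (p : pullback x g) (R : pullback (idm P) (pr1 p)) (Q : pullback f g).
Variable q : hom R Q.
Hypothesis q1 : pr1 Q ∘ q = e ∘ pr1 R.
Hypothesis q2 : pr2 Q ∘ q = pr2 p ∘ pr2 R.

Let pr1E : pr1 R = pr1 p ∘ pr2 R.
Proof. by rewrite -(pb_comm R) compose1m. Qed.

(** Cancellation half of the pasting law: a cone over [e] and [pr1 Q] yields one over [x = f ∘ e]
    and [g], which factors through [p] and so through [R]. *)
Lemma paste_pair_proof1 (Z : C) (u : hom Z P) (v : hom Z Q) :
  e ∘ u = pr1 Q ∘ v -> x ∘ u = g ∘ (pr2 Q ∘ v).
Proof. by move=> sq; rewrite composeA -(pb_comm Q) -composeA -sq composeA fe. Qed.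

Lemma paste_pair_proof2 (Z : C) (u : hom Z P) (v : hom Z Q) (sq : e ∘ u = pr1 Q ∘ v) :
  idm P ∘ u = pr1 p ∘ pb_pair p (paste_pair_proof1 sq).
Proof. by rewrite compose1m pb_pair1. Qed.

Definition paste_pair (Z : C) (u : hom Z P) (v : hom Z Q) (sq : e ∘ u = pr1 Q ∘ v) :
  hom Z R := pb_pair R (paste_pair_proof2 sq).

Lemma paste_pair2 (Z : C) (u : hom Z P) (v : hom Z Q) (sq : e ∘ u = pr1 Q ∘ v) :
  q ∘ paste_pair sq = v.
Proof.
apply: pb_joint_mono; rewrite composeA ?q1 ?q2 -composeA ?pb_pair1 //.
by rewrite !pb_pair2.
Qed.

Lemma paste_joint_mono (Z : C) (w w' : hom Z R) :
  pr1 R ∘ w = pr1 R ∘ w' -> q ∘ w = q ∘ w' -> w = w'.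
Proof.
move=> w1 w2; apply: pb_joint_mono => //.
apply: pb_joint_mono; rewrite !composeA; first by rewrite -pr1E.
by rewrite -q2 -!composeA w2.
Qed.

(* [R] is [P ×_X B] again: pulling back along [idm P] only serves to match
   the shape of the elements of [ten_P]. *)
Definition paste : pullback e (pr1 Q) :=
  @Pullback C P Q D e (pr1 Q) R (pr1 R) q (esym q1) paste_pair
    (fun Z u v sq => pb_pair1 R (paste_pair_proof2 sq)) paste_pair2 paste_joint_mono.
End Paste.

(** * Right classes and transposition in a factorization system *)

Section FactorizationSystem.
Variables (C : category) (E M : mor_class C).
Hypothesis fs : factorization_system E M.

(** Existence of fillers suffices: for [f = m ∘ e], filling against [idm X] gives a retraction [d]
    of [e], and [e ∘ d] is the identity since both fill the square with sides [e] and [m]. *)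
Lemma fs_M_lifting (X Y : C) (f : hom X Y) :
  (forall (A B : C) (e : hom A B) (u : hom A X) (v : hom B Y),
     E e -> f ∘ u = v ∘ e -> exists d, d ∘ e = u /\ f ∘ d = v) -> M f.
Proof.
move=> lift; have [Z [e [m [Ee [Mm fE]]]]] := fs_factor fs f.
have [|d [de fd]] := lift _ _ e (idm X) m Ee; first by rewrite composem1.
have [d0 [_ d0_uniq]] := fs_orthogonal fs Ee Mm (erefl (m ∘ e)).
rewrite -fE; apply: (fs_compM fs) => //; apply: (fs_isoM fs).
exists d; split=> //.
transitivity d0; last by apply: d0_uniq; rewrite compose1m composem1.
by apply/esym/d0_uniq; rewrite -composeA de composem1 composeA fE.
Qed.

Lemma fs_M_pr1 (A B X : C) (f : hom A X) (g : hom B X) (p : pullback f g) :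
  M g -> M (pr1 p).
Proof.
move=> Mg; apply: fs_M_lifting => Z W e u v Ee sq.
have sqg : g ∘ (pr2 p ∘ u) = (f ∘ v) ∘ e.
  by rewrite composeA -pb_comm -composeA sq composeA.
have [d [[de gd] _]] := fs_orthogonal fs Ee Mg sqg.
exists (pb_pair p (esym gd)); split; last exact: pb_pair1.
by apply: pb_joint_mono; rewrite composeA ?pb_pair1 ?pb_pair2.
Qed.

Lemma fs_M_pr2 (A B X : C) (f : hom A X) (g : hom B X) (p : pullback f g) :
  M f -> M (pr2 p).
Proof. exact: (fs_M_pr1 (pullback_swap p)). Qed.

Section Transpose.
Variables (P X : C) (x : hom P X) (a b : slice X) (e : hom P (dom a)).
Hypothesis xE : str a ∘ e = x.
Variable p : pullback x (str b).

Lemma transpose_proof (g : over_hom a b) : x ∘ idm P = str b ∘ (proj1_sig g ∘ e).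
Proof. by rewrite composem1 composeA (proj2_sig g). Qed.

(** The first two bijections of the overview combined: restriction along [e], then base change along
    [x]. *)
Definition transpose (g : over_hom a b) : over_hom (Over (idm P)) (Over (pr1 p)) :=
  exist (fun k : hom (dom (Over (idm P))) (dom (Over (pr1 p))) =>
           str (Over (pr1 p)) ∘ k = str (Over (idm P)))
    (pb_pair p (transpose_proof g)) (pb_pair1 p (transpose_proof g)).

Lemma transpose_bijective : E e -> M (str b) -> bijective transpose.
Proof.
move=> Ee Mb; apply: inj_surj_bijective => [g g' kE|[k kP]].
(* Maps with equal transposes agree on [e], so they fill the same square. *)
- have gE : proj1_sig g ∘ e = proj1_sig g' ∘ e.
    rewrite -(pb_pair2 p (transpose_proof g)) -(pb_pair2 p (transpose_proof g')).
    by congr (_ ∘ _); exact: (congr1 (@proj1_sig _ _) kE).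
  have sq : str b ∘ (proj1_sig g ∘ e) = str a ∘ e by rewrite composeA (proj2_sig g).
  have [d [_ d_uniq]] := fs_orthogonal fs Ee Mb sq.
  apply: over_hom_eq; transitivity d; first exact/esym/d_uniq/(conj erefl)/(proj2_sig g).
  exact/d_uniq/(conj (esym gE))/(proj2_sig g').
(* The preimage of a section [k] of [pr1 p] is the filler extending [pr2 p ∘ k] along [e]. *)
- rewrite /= in k kP *.
  have sq : str b ∘ (pr2 p ∘ k) = str a ∘ e.
    by rewrite composeA -pb_comm -composeA kP composem1 xE.
  have [d [[de bd] _]] := fs_orthogonal fs Ee Mb sq.
  exists (exist _ d bd); apply: over_hom_eq => /=.
  by apply: pb_joint_mono; rewrite ?pb_pair1 ?pb_pair2.
Qed.
End Transpose.
End FactorizationSystem.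

(** * Maps inverted by a reflection *)

Section ReflectionInverts.
Variables (C D : category) (G : functor D C) (L : left_adjoint G).

(** The objects [G d] are local for [f]; extending the unit at [Y] along [f] and transposing gives
    the inverse. *)
Lemma reflection_inverts (Y Z : C) (f : hom Y Z) :
  (forall (d : D) (u : hom Y (G d)), exists! v, v ∘ f = u) ->
  is_iso (fmap L f).
Proof.
move=> ext.
have LE (x : C) (d : D) (g g' : hom (L x) d) :
    fmap G g ∘ la_unit L x = fmap G g' ∘ la_unit L x -> g = g'.
  move=> gE; have [k [_ k_uniq]] := la_universal L (fmap G g' ∘ la_unit L x).
  by rewrite -(k_uniq _ gE); exact: k_uniq.
have [v [vf _]] := ext _ (la_unit L Y).
have [g [gv _]] := la_universal L v.
exists g; split; apply: LE; rewrite fmapM fmap1 compose1m -composeA.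
  by rewrite la_natural composeA gv.
rewrite gv.
(* Both [fmap G (fmap L f) ∘ v] and the unit at [Z] extend this map along [f]. *)
have [w [_ w_uniq]] := ext _ (la_unit L Z ∘ f).
rewrite -(w_uniq (la_unit L Z)) //; apply/esym/w_uniq.
by rewrite -composeA vf la_natural.
Qed.
End ReflectionInverts.

(** Squares over a terminal object always commute, so orthogonality becomes locality. *)
Lemma fs_orthogonal_terminal (C : category) (E M : mor_class C)
    (fs : factorization_system E M) (T : terminal C) (Y Z S : C)
    (f : hom Y Z) (m : hom S T) (u : hom Y S) :
  E _ _ f -> M _ _ m -> exists! v, v ∘ f = u.
Proof.
move=> Ef Mm.
have toT (W : C) (h h' : hom W T) : h = h'.
  by rewrite (bang_unique h) (bang_unique h').
have [v [[vf _] v_uniq]] := fs_orthogonal fs Ef Mm (toT _ (m ∘ u) (bang T Z ∘ f)).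
by exists v; split=> // w wf; apply: v_uniq; split=> //; exact: toT.
Qed.

(** * Transporting the bicartesian element from [P] to [X] *)

Section Reflections.
Variables (C : bfc) (C_strong : strong C) (pi0 : left_adjoint (inclS C)).

Lemma Pi0_inverts_E (Y Z : C) (f : hom Y Z) : clE f -> is_iso (fmap (Pi0 pi0) f).
Proof.
move=> Ef; case: (@reflection_inverts _ _ _ pi0 _ _ f) => [[a Ma] u|g [gf fg]].
  exact: (fs_orthogonal_terminal (bfc_fs C) _ Ef Ma).
exists (proj1_sig g); split; first by rewrite -[LHS]/(proj1_sig (g ∘ _)) gf.
by rewrite -[LHS]/(proj1_sig (_ ∘ g)) fg.
Qed.

Lemma Pi0_inverts_E' (Y Z : C) (f : hom Y Z) : clE' f -> is_iso (fmap (Pi0 pi0) f).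
Proof.
move=> Ef; case: (@reflection_inverts _ _ _ pi0 _ _ f) => [[a Ma] u|g [gf fg]].
  exact: (fs_orthogonal_terminal (bfc_fs' C) _ Ef (proj1 (C_strong a) Ma)).
exists (proj1_sig g); split; first by rewrite -[LHS]/(proj1_sig (g ∘ _)) gf.
by rewrite -[LHS]/(proj1_sig (_ ∘ g)) fg.
Qed.

Variables (P X : C) (x : hom P X) (n : sliceM' X) (m : sliceM X).
Variables (e' : hom P (dom (proj1_sig n))) (e : hom P (dom (proj1_sig m))).
Hypotheses (Ee' : clE' e') (Ee : clE e).
Hypotheses (ne' : str (proj1_sig n) ∘ e' = x) (me : str (proj1_sig m) ∘ e = x).

Let PP := fiber_prod (Over (idm P)) (Over (idm P)).
Let DA := fiber_prod (proj1_sig n) (proj1_sig m).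

Lemma reflections_square :
  str (proj1_sig n) ∘ (e' ∘ pr1 PP) = str (proj1_sig m) ∘ (e ∘ pr2 PP).
Proof.
by rewrite !composeA ne' me; have := pb_comm PP; rewrite /= !compose1m => ->.
Qed.

Definition reflections_elt (s : bim (ten pi0 P) (idM' P) (idM P)) : bim (ten pi0 X) n m :=
  fmap (Pi0 pi0) (pb_pair DA reflections_square) ∘ s.

Section Right.
Variable m' : sliceM X.
Let p := pb (bfc_lim C) x (str (proj1_sig m')).
Let xm' : sliceM P := exist (@inM C P) (Over (pr1 p))
  (fs_M_pr1 (bfc_fs C) p (proj2_sig m')).
Let R := fiber_prod (Over (idm P)) (Over (pr1 p)).
Let Q := fiber_prod (proj1_sig n) (proj1_sig m').

Lemma base_change_r_proof :
  str (proj1_sig n) ∘ (e' ∘ pr1 R) = str (proj1_sig m') ∘ (pr2 p ∘ pr2 R).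
Proof.
rewrite !composeA ne' -(pb_comm p) -composeA.
by have := pb_comm R; rewrite /= compose1m => ->.
Qed.

Let q := pb_pair Q base_change_r_proof.

Lemma reflections_elt_r (s : bim (ten pi0 P) (idM' P) (idM P)) :
  bicartesian s ->
  bijective (fun g : hom m m' => actr g (reflections_elt s)).
Proof.
case=> s_bij _.
have t_bij := transpose_bijective (bfc_fs C) me p Ee (proj2_sig m').
have Eq : clE' q.
  apply: (bfc_stable' (paste ne' (pb_pair1 Q _) (pb_pair2 Q _))) => //.
  exact (fs_M_pr1 (bfc_fs C) Q (proj2_sig m')).
have q_bij := @iso_compose_bijective _ (pt C) _ _ _ (Pi0_inverts_E' Eq).
(* By functoriality of [Pi0], the action agrees with this composite once two maps from [P ×_P P] to
   [Q] agree on both projections. *)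
apply: (eq_bij (bij_comp q_bij (bij_comp (s_bij xm') t_bij))) => g.
rewrite /= /reflections_elt /actr /= /ten_map /= !composeA -!(fmapM (Pi0 pi0)).
congr (fmap (Pi0 pi0) _ ∘ _); apply: pb_joint_mono; rewrite !composeA.
  by rewrite !pb_pair1 -!composeA !pb_pair1 !compose1m.
rewrite !pb_pair2 -!composeA !pb_pair2 /=.
by rewrite composeA pb_pair2 composeA.
Qed.
End Right.

Section Left.
Variable n' : sliceM' X.
Let p := pb (bfc_lim C) x (str (proj1_sig n')).
Let xn' : sliceM' P := exist (@inM' C P) (Over (pr1 p))
  (fs_M_pr1 (bfc_fs' C) p (proj2_sig n')).
Let R := fiber_prod (Over (pr1 p)) (Over (idm P)).
Let Q := fiber_prod (proj1_sig n') (proj1_sig m).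

Lemma base_change_l_proof :
  str (proj1_sig n') ∘ (pr2 p ∘ pr1 R) = str (proj1_sig m) ∘ (e ∘ pr2 R).
Proof.
rewrite !composeA me -(pb_comm p) -composeA.
by have := pb_comm R; rewrite /= compose1m => ->.
Qed.

Let q := pb_pair Q base_change_l_proof.

Lemma reflections_elt_l (s : bim (ten pi0 P) (idM' P) (idM P)) :
  bicartesian s ->
  bijective (fun h : hom n n' => actl h (reflections_elt s)).
Proof.
case=> _ s_bij.
have t_bij := transpose_bijective (bfc_fs' C) ne' p Ee' (proj2_sig n').
have Eq : clE q.
  (* The two systems exchange roles: swapping both pullbacks exhibits [q] as the pullback of [e]
     along [pr2 Q], which lies in [M']. *)
  apply: (bfc_stable (@paste _ _ _ _ _ _ _ _ _ me p (pullback_swap R)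
    (pullback_swap Q) q (pb_pair2 Q _) (pb_pair1 Q _))) => //.
  exact (fs_M_pr2 (bfc_fs' C) Q (proj2_sig n')).
have q_bij := @iso_compose_bijective _ (pt C) _ _ _ (Pi0_inverts_E Eq).
apply: (eq_bij (bij_comp q_bij (bij_comp (s_bij xn') t_bij))) => h.
rewrite /= /reflections_elt /actl /= /ten_map /= !composeA -!(fmapM (Pi0 pi0)).
congr (fmap (Pi0 pi0) _ ∘ _); apply: pb_joint_mono; rewrite !composeA.
  rewrite !pb_pair1 -!composeA !pb_pair1 /=.
  by rewrite composeA pb_pair2 composeA.
by rewrite !pb_pair2 -!composeA !pb_pair2 !compose1m.
Qed.
End Left.

Lemma reflections_elt_bicartesian (s : bim (ten pi0 P) (idM' P) (idM P)) :
  bicartesian s -> bicartesian (reflections_elt s).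
Proof. by move=> s_bi; split=> ?; [exact: reflections_elt_r | exact: reflections_elt_l]. Qed.
End Reflections.

Theorem proposition9p9 (C : bfc) (C_strong : strong C)
    (pi0 : left_adjoint (inclS C)) (C_null : nullstellensatz pi0)
    (P : C) (P_atom : atom pi0 P) (X : C) (x : hom P X) :
  (forall m : sliceM X, is_down x m -> conjugate_r (ten pi0 X) m) /\
  (forall n : sliceM' X, is_up x n -> conjugate_l (ten pi0 X) n).
Proof.
have [s s_bi] := P_atom; split.
- move=> m [e [Ee me]].
  (* The conjugate partner of a reflection of [x] is the reflection of [x] on the other side. *)
  have [D [e' [f [Ee' [M'f fe']]]]] := fs_factor (bfc_fs' C) x.
  pose n : sliceM' X := exist (@inM' C X) (Over f) M'f.
  exists n, (reflections_elt (n := n) fe' me s).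
  exact: reflections_elt_bicartesian.
- move=> n [e' [Ee' ne']].
  have [A [e [f [Ee [Mf fe]]]]] := fs_factor (bfc_fs C) x.
  pose m : sliceM X := exist (@inM C X) (Over f) Mf.
  exists m, (reflections_elt (m := m) ne' fe s).
  exact: reflections_elt_bicartesian.
Qed.
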